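(* If $\lambda$ is a cardinal with $\lambda>\omega_1$, then the hyperspace $\exp(D^\lambda)$ with the Vietoris topology is universally Kuratowski-Ulam$^*$ (uK-U$^*$) and is not dyadic.
   Context: $D=\{0,1\}$ is the two-point discrete space, and $D^\lambda$ is the Cantor cube with the product topology. The hyperspace $\exp(X)$ is the set of all non-empty closed subsets of $X$; the Vietoris topology on it has as a base the sets $\langle V_1,\ldots,V_n\rangle=\{A\in\exp(X): A\subseteq V_1\cup\cdots\cup V_n\text{ and }A\cap V_i\neq\emptyset\text{ for }1\leq i\leq n\}$, where $n\geq 1$ and $V_1,\ldots,V_n$ are open subsets of $X$. A compact Hausdorff space is dyadic if it is a continuous image of a Cantor cube $D^\kappa$ for some cardinal $\kappa$. A set is meager if it is a countable union of nowhere dense sets. A space $Z$ is universally Kuratowski-Ulam$^*$ (uK-U$^*$) if for every topological space $X$ and every nowhere dense set $E\subseteq X\times Z$ (product topology), the set $\{x\in X:\{z\in Z:(x,z)\in E\}\text{ is not nowhere dense in }Z\}$ is meager in $X$. *)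

(* Defs.v *)
From HB Require Import structures.
From mathcomp Require Import all_boot all_order all_algebra.
From mathcomp Require Import all_classical all_reals all_analysis.

Set Implicit Arguments.
Unset Strict Implicit.
Unset Printing Implicit Defensive.

Local Open Scope classical_set_scope.
Local Open Scope card_scope.

(** [R], read as [<=], is a well-order of type omega_1: the uncountable
    well-order all of whose initial segments are countable. *)
Definition is_omega1 (W : eqType) (R : rel W) : Prop :=
  [/\ wochoice.well_order R,
      ~ countable [set: W]
    & forall x : W, countable [set y : W | R y x]].

(** Cardinals are represented by types, compared by means of injections. *)
Definition omega1_lt (L : Type) : Prop :=
  exists (W : eqType) (R : rel W),
    [/\ is_omega1 R,
        [set: W] #<= [set: L]
      & ~ ([set: L] #<= [set: W])].

Lemma set_nat_uncountable : ~ countable [set: set nat].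
Proof.
move=> /countable_injP[f finj].
pose D := [set n | exists A, f A = n /\ ~ A n].
have : ~ D (f D).
  move=> [A [/finj AD nA]]; apply: (nA); rewrite AD ?inE//; last first.
  by exists A; split => //; rewrite AD ?inE.
by move=> nD; apply: (nD); exists D.
Qed.

(** The well-order in [omega1_lt] does exist. *)
Lemma omega1_exists : exists (W : eqType) (R : rel W), is_omega1 R.
Proof.
have [R Rwo] := wochoice.well_ordering_principle (set nat : eqType).
have Rwoc : wochoice.wo_chain R predT by move=> A _; exact: Rwo.
have Ranti x y : R x y -> R y x -> x = y.
  move=> xy yx; apply: (wochoice.wo_chain_antisymmetric Rwoc) => //.
  by rewrite xy.
have [cR|] := pselect (forall x, countable [set y | R y x]).
  by exists (set nat : eqType), R; split => //; exact: set_nat_uncountable.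
rewrite -existsNE => -[x0 ncx0].
have [|m [[/asboolP ncm m_min] _]] :=
    Rwo (fun x => `[< ~ countable [set y | R y x] >]).
  by exists x0; exact/asboolP.
pose W := {y : set nat | R y m && (y != m)}.
exists W, (relpre val R); split.
- apply: wochoice.antisymmetric_well_order => [x y /andP[xy yx]|A [a Aa]].
    exact/val_inj/Ranti.
  have [|z [[/asboolP[w Aw <-] z_min] _]] :=
      Rwo (fun x => `[< exists2 w : W, w \in A & val w = x >]).
    by exists (val a); apply/asboolP; exists a.
  exists w; split=> // w' Aw'; apply: z_min.
  by apply/asboolP; exists w'.
- move=> /countable_injP[g ginj]; apply: ncm; apply/countable_injP.
  exists (fun y => if insub y is Some w then (g (w : W)).+1 else 0%N).
  move=> x y; rewrite !inE/= => xm ym.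
  case: insubP => [u _ ux|]; case: insubP => [v _ vy|] //.
    by move=> [] /ginj uv; rewrite -ux -vy uv ?inE.
  by rewrite ym xm/= !negbK => /eqP-> /eqP->.
- move=> x; have cx : countable [set y | R y (val x)].
    apply: contrapT => ncx; have /andP[xm /eqP] := valP x; apply.
    by apply: Ranti => //; apply: m_min; exact/asboolP.
  have /countable_injP[f finj] := cx; apply/countable_injP.
  exists (f \o val) => u v; rewrite !inE/= => ux vx fuv.
  by apply/val_inj/finj; rewrite ?inE.
Qed.

(** [{ptws _ -> _}] carries the product topology, and [bool] the discrete one. *)
Definition cantor_cube (L : Type) : topologicalType := {ptws L -> bool}.

Section Vietoris.
Context {X : topologicalType}.

Definition hyperspace_of : Type := {A : set X | closed A /\ A !=set0}.

HB.instance Definition _ := gen_eqMixin hyperspace_of.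
HB.instance Definition _ := gen_choiceMixin hyperspace_of.

(** The basic set [<V_0, ..., V_n>] is indexed by the pair [(n, V)]; the values
    [V i] for [i > n] are irrelevant, and there are [n + 1 >= 1] sets [V_i]. *)
Definition vietoris_basic (nV : nat * (nat -> set X)) : set hyperspace_of :=
  [set A | sval A `<=` \bigcup_(i in `I_nV.1.+1) nV.2 i /\
           forall i, (i <= nV.1)%N -> sval A `&` nV.2 i !=set0].

Definition vietoris_index : set (nat * (nat -> set X)) :=
  [set nV | forall i, (i <= nV.1)%N -> open (nV.2 i)].

Lemma vietoris_cover :
  \bigcup_(nV in vietoris_index) vietoris_basic nV = setT.
Proof.
apply/seteqP; split => // -[A [clA A0]] _.
exists (0%N, fun=> setT) => /=; first by move=> i _; exact: openT.
by split => [x Ax|i _] /=; [exists 0%N | rewrite setIT].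
Qed.

Lemma vietoris_join (nU mV : nat * (nat -> set X)) (A : hyperspace_of) :
  vietoris_index nU -> vietoris_index mV ->
  vietoris_basic nU A -> vietoris_basic mV A ->
  exists kW, [/\ vietoris_index kW, vietoris_basic kW A
    & vietoris_basic kW `<=` vietoris_basic nU `&` vietoris_basic mV].
Proof.
case: nU mV => [n U] [m V]; rewrite /vietoris_index /= => oU oV.
move=> [/= AU AUi] [/= AV AVi].
pose bU := \bigcup_(i in `I_n.+1) U i; pose bV := \bigcup_(i in `I_m.+1) V i.
have obU : open bU by apply: bigcup_open => i /=; rewrite ltnS; exact: oU.
have obV : open bV by apply: bigcup_open => i /=; rewrite ltnS; exact: oV.
pose W k := if (k <= n)%N then U k `&` bV else V (k - n.+1)%N `&` bU.
have WU i : (i <= n)%N -> W i = U i `&` bV by rewrite /W => ->.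
have WV i : W (n.+1 + i)%N = V i `&` bU.
  by rewrite /W leqNgt addSn ltnS leq_addr /= -addSn addKn.
have split_index k : (k <= n.+1 + m)%N ->
    (k <= n)%N \/ exists2 i, (i <= m)%N & k = (n.+1 + i)%N.
  case: (leqP k n) => [|nk] km; [by left|right].
  by exists (k - n.+1)%N; rewrite ?subnKC// leq_subLR.
exists ((n.+1 + m)%N, W); split => /=.
- move=> k /split_index[kn|[i im ->]].
    by rewrite WU//; apply: openI => //; exact: oU.
  by rewrite WV; apply: openI => //; exact: oV.
- split => /= [x Ax|k /split_index[kn|[i im ->]]].
  + have [i /= iN Ui] := AU _ Ax.
    exists i => /=; first by rewrite (leq_trans iN)// ltnS leqW// leq_addr.
    by rewrite WU//; split => //; exact: AV.
  + have [x [Ax Ux]] := AUi _ kn; exists x; split => //.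
    by rewrite WU//; split => //; exact: AV.
  + have [x [Ax Vx]] := AVi _ im; exists x; split => //.
    by rewrite WV; split => //; exact: AU.
- move=> B [/= BW BWi]; split; split => /=.
  + move=> x /BW[k /=]; rewrite ltnS => /split_index[kn|[i im ->]].
      by rewrite WU// => -[Ux _]; exists k.
    by rewrite WV => -[_].
  + move=> i iN; have [|x [Bx]] := BWi i.
      by rewrite (leq_trans iN)// leqW// leq_addr.
    by rewrite WU// => -[Ux _]; exists x.
  + move=> x /BW[k /=]; rewrite ltnS => /split_index[kn|[i im ->]].
      by rewrite WU// => -[].
    by rewrite WV => -[Vx _]; exists i.
  + move=> i im; have [|x [Bx]] := BWi (n.+1 + i)%N.
      by rewrite leq_add2l.
    by rewrite WV => -[Vx _]; exists x.
Qed.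

HB.instance Definition _ :=
  isBaseTopological.Build hyperspace_of vietoris_cover vietoris_join.

End Vietoris.

Arguments hyperspace_of : clear implicits.

Definition hyperspace (X : topologicalType) : topologicalType :=
  hyperspace_of X.

Definition dyadic (Z : topologicalType) : Prop :=
  [/\ compact [set: Z],
      hausdorff_space Z
    & exists (K : Type) (f : cantor_cube K -> Z),
        continuous f /\ range f = [set: Z]].

Definition nowhere_dense (T : topologicalType) (A : set T) : Prop :=
  interior (closure A) = set0.

Definition meager (T : topologicalType) (A : set T) : Prop :=
  exists2 F : nat -> set T, (forall n, nowhere_dense (F n)) &
    A = \bigcup_n F n.

(** uK-U stands for "universally Kuratowski-Ulam". *)
Definition uKU_star (Z : topologicalType) : Prop :=
  forall (X : topologicalType) (E : set (X * Z)), nowhere_dense E ->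
    meager [set x : X | ~ nowhere_dense [set z : Z | E (x, z)]].

(* Main.v *)
Require Import Defs.
From mathcomp Require Import all_boot all_order all_algebra.
From mathcomp Require Import finmap.
From mathcomp Require Import all_classical all_reals all_analysis.

Set Implicit Arguments.
Unset Strict Implicit.
Unset Printing Implicit Defensive.

Local Open Scope classical_set_scope.
Local Open Scope card_scope.

(** uK-U*.  Basic open sets of [exp (2 ^ L)] fix the projection of a closed set
    to a finite subcube.  Given a closed nowhere dense [E], take a tree of open
    sets of [X] labelled by increasing finite [s_n] such that along a branch
    through [x] every pattern on [s_n] has a refinement on [s_(n+1)] disjoint
    from the section [E_x].  A finite [u] meets the union of the [s_n] inside a
    single [s_n], so every pattern on [u] amalgamates with such a refinement,
    and [E_x] is nowhere dense for all [x] outside a meager set.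

    Non-dyadicity.  Let [f] map [2 ^ K] onto [exp (2 ^ L)] and fix distinct
    [rho_0, rho_1, ...] in [L].  The projection of [f q] to a finite [2 ^ s]
    depends on finitely many coordinates [supp s] of [q].  Let [n] bound the size
    of [supp {x, y}] and let [t] contain the intersection of the supports of
    [{rho_<n, x}] and [{rho_<n, y}].  If [a x = a y] for all [a] in [f q], then
    the projections of [f q] to [{rho_<n, x}] and [{rho_<n, y}] agree, so they
    are determined by [q] on [t] and [supp {x, y}].  With [m] disjoint pairs
    [{x_i, y_i}] of this kind, all [2 ^ (2 ^ n * m)] choices of functions
    [h_i : 2 ^ n -> 2] arise from the closed sets
    [{a | a x_i = a y_i = h_i (a rho_<n) for all i}], whence
    [2 ^ n * m <= #|t| + n * m] and [m <= #|t|].  Hence a finite set [Z n t] meets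
    every pair of this kind, and [Phi x], the union of the [Z n t] over [n] and
    [t] included in the support of [{rho_<n, x}], is a countable set such that
    [x] is in [Phi y] or [y] is in [Phi x] for all [x], [y].  That is impossible
    when [L] has more than [omega_1] elements. *)

(** * Finite supports *)

Lemma cantor_cube_nbhsP (L : eqType) (a : cantor_cube L)
    (U : set (cantor_cube L)) :
  nbhs a U <-> exists s : seq L, forall b, {in s, a =1 b} -> U b.
Proof.
split=> [[P [[Q QfinP <-] [V JV Va] VU]]|[s]].
- have {}Va : (V : set (cantor_cube L)) a := Va.
  have [F Fsub VE] := QfinP _ JV.
  have HF (M : set (cantor_cube L)) : M \in F ->
      exists s : seq L, forall b, {in s, a =1 b} -> M b.
    move=> MF; have /set_mem[i _ [W oW WM]] := Fsub _ MF.
    exists [:: i] => b /(_ i); rewrite inE eqxx => /(_ isT) abi.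
    have Ma : M a by move: Va; rewrite -VE; apply.
    by move: Ma; rewrite -WM /= abi.
  have [g gP] := choice (fun M : {M : set (cantor_cube L) | M \in F} =>
    HF (val M) (valP M)).
  exists (flatten [seq (if insub M is Some u then g u else [::]) | M <- F]).
  move=> b ab; apply: VU; exists V => //.
  suff : (V : set (cantor_cube L)) b by [].
  rewrite -VE => M /= MF.
  apply: (gP (Sub M MF)) => i ig; apply: ab; apply/flatten_mapP.
  by exists M => //; rewrite insubT.
- elim: s U => [|i s IHs] U sU.
    by apply: filterS filterT => b _; exact: sU.
  have ni : nbhs a [set b : cantor_cube L | a i = b i].
    have := @proj_continuous L (fun=> bool) i a [set x | a i = x].
    by apply; apply: open_nbhs_nbhs; split=> //; exact: discrete_open.
  have ns : nbhs a [set b : cantor_cube L | {in s, a =1 b}] by exact: IHs.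
  apply: filterS (filterI ni ns) => b [abi abs]; apply: sU => j.
  by rewrite inE => /predU1P[->|/abs].
Qed.

Lemma cantor_cube_compact (L : eqType) : compact [set: cantor_cube L].
Proof.
have := @tychonoff L (fun=> bool) (fun=> setT) (fun=> bool_compact).
by congr compact; apply/seteqP; split.
Qed.

Lemma eventually_subset_filter (L : eqType) :
  Filter (filter_from [set: seq L]
    (fun s => [set t : seq L | {subset s <= t}])).
Proof.
apply: filter_fromT_filter => [|s t]; first by exists [::].
exists (s ++ t) => u /= stu; split=> i it; apply: stu;
  by rewrite mem_cat it ?orbT.
Qed.

(* Compactness of [K], applied along the filter of finite sets of coordinates
   ordered by inclusion. *)
Lemma compact_finite_support (L : eqType) (K : set (cantor_cube L))
    (P : seq L -> cantor_cube L -> Prop) :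
  compact K ->
  (forall s t a, {subset s <= t} -> P s a -> P t a) ->
  (forall a, K a -> exists s, \forall b \near a, P s b) ->
  exists s, K `<=` P s.
Proof.
move=> /compact_near_coveringP cK Pmono Pnear.
have FF := eventually_subset_filter L.
have [|s _ sK] := cK _ _ P FF.
  move=> a /Pnear[s sP].
  exists ([set b | P s b], [set t : seq L | {subset s <= t}]).
    by split=> //; exists s.
  by move=> [b t] [/= Pb st]; exact: Pmono st Pb.
by exists s; exact: sK.
Qed.

(** Around each point [g] is constant on a cylinder, and compactness leaves one finite set of
    coordinates for all points. Applied to the patterns of [f q], this gives [supp]. *)
Lemma locally_constant_finite_support (L : eqType) (T : Type)
    (g : cantor_cube L -> T) :
  (forall a, \forall b \near a, g b = g a) ->
  exists s : seq L, forall a b, {in s, a =1 b} -> g a = g b.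
Proof.
move=> g_lc; have [|||s sP] := @compact_finite_support L setT
  (fun s a => forall b, {in s, a =1 b} -> g a = g b).
- exact: cantor_cube_compact.
- by move=> s t a st sa b ab; apply: sa => i /st; exact: ab.
- move=> a _; have /cantor_cube_nbhsP[s sa] := g_lc a; exists s.
  apply/cantor_cube_nbhsP; exists s => b ab c bc.
  by rewrite (sa b)// (sa c)// => i si; rewrite ab// bc.
- by exists s => a; exact: sP.
Qed.

(** * The Vietoris topology through finite projections *)

Lemma vietoris_nbhsP (X : topologicalType) (A : hyperspace X)
    (U : set (hyperspace X)) :
  nbhs A U <-> exists nV, [/\ vietoris_index nV, vietoris_basic nV A &
                              vietoris_basic nV `<=` U].
Proof.
split=> [[P [[Q QI <-] [nV QnV nVA] QU]]|[nV [inV nVA nVU]]].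
  by exists nV; split; [exact: QI|exact: nVA|move=> B nVB; apply: QU; exists nV].
exists (vietoris_basic nV); split=> //.
by exists [set nV]; rewrite ?bigcup_set1// => _ ->.
Qed.

Lemma vietoris_nbhs_subset (X : topologicalType) (V : set X) (A : hyperspace X) :
  open V -> sval A `<=` V -> nbhs A [set B : hyperspace X | sval B `<=` V].
Proof.
move=> oV AV; apply/vietoris_nbhsP; exists (0%N, fun=> V); split=> //=.
- split=> [a Aa|i _ /=]; first by exists 0%N => //; exact: AV.
  by have [a Aa] := (svalP A).2; exists a; split=> //; exact: AV.
- by move=> B [BV _] b /BV[].
Qed.

Lemma vietoris_nbhs_meet (X : topologicalType) (V : set X) (A : hyperspace X) :
  open V -> sval A `&` V !=set0 ->
  nbhs A [set B : hyperspace X | sval B `&` V !=set0].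
Proof.
move=> oV AV; apply/vietoris_nbhsP.
(* The second set is the whole space, so that the covering condition holds for every [B]. *)
exists (1%N, fun i => if i is 0%N then V else setT); split=> /=.
- by move=> [|i] //= _; exact: openT.
- split=> [a Aa|[|i] //= _]; first by exists 1%N.
  by rewrite setIT; exact: (svalP A).2.
- by move=> B [_ /(_ 0%N isT)].
Qed.

Section pattern.
Context {L : eqType}.
Implicit Types (s : seq L) (A B : set (cantor_cube L)) (a b c : cantor_cube L).

(* The projection of [A] to the finite cube [2 ^ s]. *)
Definition pattern s A : {ffun (size s).-tuple bool -> bool} :=
  [ffun t : (size s).-tuple bool =>
    `[< exists2 a, A a & map a s = t :> seq bool >]].

Lemma eq_patternP s A B : pattern s A = pattern s B <->
  (forall a, A a -> exists2 b, B b & {in s, a =1 b}) /\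
  (forall b, B b -> exists2 a, A a & {in s, a =1 b}).
Proof.
have patternT C c : C c -> pattern s C (map_tuple (c : L -> bool) (in_tuple s)).
  by move=> Cc; rewrite ffunE; apply/asboolP; exists c.
split=> [AB|[AB BA]]; first split.
- move=> a /patternT; rewrite AB ffunE => /asboolP[b Bb /eq_in_map ba].
  by exists b => // i /ba.
- move=> b /patternT; rewrite -AB ffunE => /asboolP[a Aa /eq_in_map ba].
  by exists a.
- apply/ffunP => t; rewrite !ffunE; apply/asbool_equiv_eq; split.
    move=> [a /AB[b Bb ab] <-]; exists b => //.
    by apply/eq_in_map => i /ab.
  by move=> [b /BA[a Aa ab] <-]; exists a => //; apply/eq_in_map => i /ab.
Qed.

Lemma subset_pattern s t A B :
  {subset s <= t} -> pattern t A = pattern t B -> pattern s A = pattern s B.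
Proof.
move=> st /eq_patternP[AB BA]; apply/eq_patternP; split.
- by move=> a /AB[b Bb ab]; exists b => // i /st /ab.
- by move=> b /BA[a Aa ab]; exists a => // i /st /ab.
Qed.

Lemma cylinder_open s (U : set (cantor_cube L)) :
  (forall a b, {in s, a =1 b} -> U a -> U b) -> open U.
Proof.
move=> sU; rewrite openE => a Ua; apply/cantor_cube_nbhsP.
by exists s => b ab; exact: sU Ua.
Qed.

Lemma cylinder_closed s (U : set (cantor_cube L)) :
  (forall a b, {in s, a =1 b} -> U a -> U b) -> closed U.
Proof.
move=> sU; rewrite -[U]setCK; apply: open_closedC.
apply: (@cylinder_open s) => a b ab nUa Ub; apply: nUa.
by apply: sU Ub => i si; rewrite ab.
Qed.

(** For each of the finitely many tuples [t], both meeting and missing the cylinder of [t] are open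
    conditions, as the cylinder is clopen. *)
Lemma pattern_nbhs s (A : hyperspace (cantor_cube L)) :
  nbhs A [set B : hyperspace (cantor_cube L) |
    pattern s (sval B) = pattern s (sval A)].
Proof.
suff : nbhs A [set B : hyperspace (cantor_cube L) |
    forall t, pattern s (sval B) t = pattern s (sval A) t].
  by apply: filterS => B BA; apply/ffunP.
apply: (@filter_forall _ _ (fun t => [set B : hyperspace (cantor_cube L) |
  pattern s (sval B) t = pattern s (sval A) t]) _ (nbhs_filter A)) => t.
rewrite /prop_near1 [pattern s (sval A) t]ffunE.
case: asboolP => [[a Aa at_]|nA].
- have : nbhs A [set B : hyperspace (cantor_cube L) |
      sval B `&` [set b | map b s = t] !=set0].
    apply: vietoris_nbhs_meet; [|by exists a].
    by apply: (@cylinder_open s) => b c /eq_in_map /= ->.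
  by apply: filterS => B [b [Bb /= bt]] /=; rewrite ffunE; apply/asboolP; exists b.
- have : nbhs A [set B : hyperspace (cantor_cube L) |
      sval B `<=` [set b | map b s <> t]].
    apply: vietoris_nbhs_subset.
      by apply: (@cylinder_open s) => b c /eq_in_map /= ->.
    by move=> a Aa /= at_; apply: nA; exists a.
  apply: filterS => B Bt /=; rewrite ffunE; apply/asboolP => -[b Bb bt].
  exact: Bt bt.
Qed.

(** By compactness, one finite [s] puts the cylinder around each point of [A] inside some [V i].
    Adding coordinates [r i] for a point of [A] in each [V i] preserves the meeting conditions. *)
Lemma pattern_nbhs_base (A : hyperspace (cantor_cube L))
    (U : set (hyperspace (cantor_cube L))) :
  nbhs A U -> exists s, forall B : hyperspace (cantor_cube L),
    pattern s (sval B) = pattern s (sval A) -> U B.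
Proof.
move=> /vietoris_nbhsP[[n V] [/= oV [/= AV AVi] VU]].
have cA : compact (sval A).
  have [clA _] := svalP A.
  have cT : compact [set: cantor_cube L] by exact: cantor_cube_compact.
  exact: subclosed_compact clA cT (@subsetT _ _).
have [||s sA] := @compact_finite_support L (sval A)
  (fun s a => exists2 i, (i <= n)%N & forall b, {in s, a =1 b} -> V i b) cA.
- move=> s t a st [i iN sV]; exists i => // b ab; apply: sV => j /st; exact: ab.
- move=> a Aa; have [i /= iN Via] := AV _ Aa.
  have /cantor_cube_nbhsP[s sV] : nbhs a (V i).
    by apply: open_nbhs_nbhs; split=> //; exact: oV.
  exists s; apply/cantor_cube_nbhsP; exists s => b ab; exists i => // c bc.
  by apply: sV => j js; rewrite ab// bc.
have /choice[r rP] : forall i, exists si : seq L, (i <= n)%N ->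
    exists2 a, sval A a & forall b, {in si, a =1 b} -> V i b.
  move=> i.
  have [iN|_] := leqP i n; last by exists [::].
  have [a [Aa Va]] := AVi _ iN.
  have /cantor_cube_nbhsP[si siV] : nbhs a (V i).
    by apply: open_nbhs_nbhs; split=> //; exact: oV.
  by exists si => _; exists a.
exists (s ++ flatten [seq r i | i <- iota 0 n.+1]) => B /eq_patternP[BA AB].
apply: VU; split=> [b /BA[a Aa ba]|i /= iN] /=.
- have [i iN iV] := sA _ Aa; exists i => //; apply: iV => j js.
  by rewrite ba// mem_cat js.
- have [a Aa iV] := rP _ iN; have [b Bb ba] := AB _ Aa.
  exists b; split=> //; apply: iV => j jr; apply/esym/ba.
  rewrite mem_cat; apply/orP; right; apply/flatten_mapP; exists i => //.
  by rewrite mem_iota.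
Qed.

End pattern.

(** * The Kuratowski-Ulam property *)

Lemma nowhere_dense_setC (X : topologicalType) (G : set X) :
  open G -> dense G -> nowhere_dense (~` G).
Proof.
move=> oG dG; rewrite /nowhere_dense.
have /closure_id <- : closed (~` G) by exact: open_closedC.
apply: contrapT => /eqP/set0P/dG/(_ (@open_interior _ _))[x [iGx Gx]].
exact: interior_subset iGx Gx.
Qed.

(* The states label a tree of open sets whose levels are maximal disjoint
   families, so that a generic point lies on exactly one branch. *)
Lemma generic_branch (X : topologicalType) (S : Type) (s0 : S)
    (R : set X -> S -> S -> Prop) :
  (forall V s, open V -> V !=set0 ->
    exists V' s', [/\ open V', V' !=set0, V' `<=` V & R V' s s']) ->
  exists2 H : nat -> set X, (forall n, nowhere_dense (H n)) &
    forall x, (forall n, ~ H n x) -> exists2 s : nat -> S, s 0%N = s0 &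
      forall n, exists2 V, V x & R V (s n) (s n.+1).
Proof.
move=> extR.
(* A level of the tree: [p.1] is the union of its open sets, [p.2] the state, locally constant
   there. *)
pose good (p : set X * (X -> S)) := [/\ open p.1, dense p.1 &
  forall x, p.1 x -> exists V, [/\ open V, V x & forall y, V y -> p.2 y = p.2 x]].
have step (p : {p | good p}) : exists q : {p | good p},
    forall x, (sval q).1 x -> exists2 V, V x & R V ((sval p).2 x) ((sval q).2 x).
  case: p => -[G f] [/= oG dG f_lc].
  pose D : set (set X) := [set V | [/\ open V, V !=set0 &
    exists s s', (forall y, V y -> f y = s) /\ R V s s']].
  have [E [ED tE maxE]] := ex_maximal_disjoint_subcollection (@id (set X)) D.
  have /choice[h hP] : forall V, exists s', D V -> forall y, V y -> R V (f y) s'.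
    move=> V; have [[_ _ [s [s' [fs Rss']]]]|nDV] := pselect (D V).
      by exists s' => _ y /fs ->.
    by exists s0 => /nDV.
  have /choice[v vP] : forall x, exists V, (\bigcup_(V in E) V) x -> E V /\ V x.
    move=> x; have [[V EV Vx]|nx] := pselect ((\bigcup_(V in E) V) x).
      by exists V.
    by exists set0 => /nx.
  have vE V x : E V -> V x -> v x = V.
    move=> EV Vx; have [Ev vx] : E (v x) /\ v x x by apply: vP; exists V.
    by apply: (tE _ _ Ev EV); exists x.
  have gq : good (\bigcup_(V in E) V, h \o v).
    split=> /=; first by apply: bigcup_open => V /ED[].
    (* If [U] missed the new level, extending inside [U] would give a member [W] of [D] disjoint
       from all of [E], against maximality. *)
    - move=> U U0 oU; apply: contrapT => UE.
      have [x [Ux Gx]] := dG _ U0 oU; have [V [oV Vx fV]] := f_lc _ Gx.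
      have [||W [s' [oW W0 WV RW]]] := extR (U `&` V) (f x).
        exact: openI.
        by exists x.
      have DW : D W.
        by split=> //; exists (f x), s'; split=> // y /WV[_ /fV].
      apply: (maxE (E `|` [set W])).
      + split; first by move=> U' EU'; left.
        move=> /(_ W (or_intror erefl)) EW; apply: UE.
        by have [y Wy] := W0; exists y; split; [exact: (WV _ Wy).1|exists W].
      + by move=> U' [/ED//|->].
      + have disj V1 : E V1 -> ~ (V1 `&` W !=set0).
          move=> EV1 [y [V1y Wy]]; apply: UE.
          by exists y; split; [exact: (WV _ Wy).1|exists V1].
        move=> V1 V2 [EV1|->] [EV2|->] //=; first exact: tE.
          by move=> /(disj _ EV1).
        by rewrite setIC => /(disj _ EV2).
    - move=> x [V EV Vx]; have [oV _ _] := ED _ EV.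
      by exists V; split=> // y Vy; rewrite (vE V x)// (vE V y).
  exists (exist _ _ gq) => /= x [V EV Vx]; exists V => //.
  by rewrite (vE V x)//; apply: hP => //; exact: ED.
have good0 : good (setT, cst s0).
  split=> /=; first exact: openT.
    by move=> U [x Ux] _; exists x.
  by move=> x _; exists setT; split=> //; exact: openT.
have /choice[next nextP] := step.
pose p n := iter n next (exist _ _ good0).
exists (fun n => ~` (sval (p n)).1) => [n|x Hx].
  by have [oG dG _] := svalP (p n); exact: nowhere_dense_setC.
exists (fun n => (sval (p n)).2 x) => // n.
by apply: nextP; apply: contrapT; exact: Hx n.+1.
Qed.

Lemma subset_nowhere_dense (X : topologicalType) (A B : set X) :
  A `<=` B -> nowhere_dense B -> nowhere_dense A.
Proof.
move=> AB; rewrite /nowhere_dense -!subset0; apply: subset_trans.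
exact/interiorS/closureS.
Qed.

(** Points of [A] and [B] that agree on [t] glue to a point following the first on [s] and the
    second on [u]. All such points form a finite-support set, hence a closed one. *)
Lemma pattern_amalgam (L : eqType) (s t u : seq L)
    (A B : hyperspace (cantor_cube L)) :
  (forall i, i \in s -> i \in u -> i \in t) ->
  pattern t (sval A) = pattern t (sval B) ->
  exists C : hyperspace (cantor_cube L),
    pattern s (sval C) = pattern s (sval A) /\
    pattern u (sval C) = pattern u (sval B).
Proof.
move=> sut /eq_patternP[AB BA].
pose C := [set a : cantor_cube L | exists b c,
  [/\ sval A b, sval B c, {in s, a =1 b} & {in u, a =1 c}]].
have glue b c : sval A b -> sval B c -> {in t, b =1 c} ->
    exists a, [/\ C a, {in s, a =1 b} & {in u, a =1 c}].
  move=> Ab Bc bc; pose a : cantor_cube L := fun i => if i \in u then c i else b i.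
  have ab : {in s, a =1 b}.
    by move=> i si; rewrite /a; case: ifPn => // ui; rewrite bc//; exact: sut.
  have ac : {in u, a =1 c} by move=> i ui; rewrite /a ui.
  by exists a; split=> //; exists b, c.
have C_prop : closed C /\ C !=set0.
  split.
    apply: (@cylinder_closed _ (s ++ u)) => a a' aa' [b [c [Ab Bc ab ac]]].
    exists b, c; split=> // i iv; rewrite -aa' ?mem_cat ?iv ?orbT//.
      exact: ab.
    exact: ac.
  have [_ [b Ab]] := svalP A; have [c Bc bc] := AB _ Ab.
  by have [a [Ca _ _]] := glue _ _ Ab Bc bc; exists a.
exists (exist _ C C_prop : hyperspace_of _); split; apply/eq_patternP; split=> /=.
- by move=> a [b [c [Ab Bc ab ac]]]; exists b.
- move=> b Ab; have [c Bc bc] := AB _ Ab.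
  by have [a [Ca ab _]] := glue _ _ Ab Bc bc; exists a.
- by move=> a [b [c [Ab Bc ab ac]]]; exists c.
- move=> c Bc; have [b Ab bc] := BA _ Bc.
  by have [a [Ca _ ac]] := glue _ _ Ab Bc bc; exists a.
Qed.

Section kuratowski_ulam.
Context {L : eqType} {X : topologicalType}.
Variable E : set (X * hyperspace (cantor_cube L)).

(** [B] merely carries a pattern on [t] that refines the pattern of [A] on [s] and is realized by a
    closed set. *)
Definition avoids (V : set X) (s t : seq L) : Prop :=
  {subset s <= t} /\ forall A : hyperspace (cantor_cube L),
    exists2 B : hyperspace (cantor_cube L),
        pattern s (sval B) = pattern s (sval A) &
      forall x (C : hyperspace (cantor_cube L)), V x ->
        pattern t (sval C) = pattern t (sval B) -> ~ closure E (x, C).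

(** The finitely many patterns on [s] are treated one by one, shrinking [V'] and enlarging [t];
    those already treated survive, since finer patterns determine coarser ones. *)
Lemma avoids_extend : nowhere_dense E -> forall (V : set X) (s : seq L),
  open V -> V !=set0 ->
  exists V' t, [/\ open V', V' !=set0, V' `<=` V & avoids V' s t].
Proof.
move=> nE V s oV V0.
suff /(_ (enum {ffun (size s).-tuple bool -> bool}))[V' [t [oV' V'0 V'V st H]]] :
    forall l : seq {ffun (size s).-tuple bool -> bool}, exists V' t,
    [/\ open V', V' !=set0, V' `<=` V, {subset s <= t} &
      forall A : hyperspace (cantor_cube L), pattern s (sval A) \in l ->
      exists2 B : hyperspace (cantor_cube L),
        pattern s (sval B) = pattern s (sval A) &
      forall x (C : hyperspace (cantor_cube L)), V' x ->
        pattern t (sval C) = pattern t (sval B) -> ~ closure E (x, C)].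
  by exists V', t; split=> //; split=> // A; apply: H; rewrite mem_enum.
elim=> [|p l [V' [t [oV' V'0 V'V st H]]]]; first by exists V, s; split.
have [[A0 A0p]|nA0] := pselect (exists A0 : hyperspace (cantor_cube L),
    pattern s (sval A0) = p); last first.
  exists V', t; split=> // A; rewrite inE => /predU1P[Ap|]; last exact: H.
  by exfalso; apply: nA0; exists A.
have [x0 V'x0] := V'0.
have nbhs0 : nbhs (x0, A0) [set xC : X * hyperspace (cantor_cube L) |
    V' xC.1 /\ pattern s (sval xC.2) = p].
  exists (V', [set C : hyperspace (cantor_cube L) | pattern s (sval C) = p]) => //=.
  by split; [exact: open_nbhs_nbhs|rewrite -A0p; exact: pattern_nbhs].
(* Otherwise the closure of [E] would contain a neighbourhood of [(x0, A0)]. *)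
have [x1 [B1 [V'x1 B1p nEB1]]] : exists x1 (B1 : hyperspace (cantor_cube L)),
    [/\ V' x1, pattern s (sval B1) = p & ~ closure E (x1, B1)].
  apply: contrapT => /forallNP nex.
  have : (closure E)° (x0, A0).
    apply: filterS nbhs0 => -[x C] [/= V'x Cp]; apply: contrapT => nExC.
    by apply: (nex x); exists C.
  by rewrite nE.
have : nbhs (x1, B1) (~` closure E).
  by apply: open_nbhs_nbhs; split=> //; exact/closed_openC/closed_closure.
move=> [[P Q] [/= nP nQ] PQ].
have [u uQ] := pattern_nbhs_base nQ.
exists (V' `&` P°), (t ++ u); split.
- by apply: openI => //; exact: open_interior.
- by exists x1; split.
- by move=> x [/V'V].
- by move=> i /st it; rewrite mem_cat it.
move=> A; rewrite inE => /predU1P[Ap|/H[B BA HB]].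
- exists B1; first by rewrite B1p.
  move=> x C [V'x /interior_subset Px] CB; apply: (PQ (x, C)); split=> //=.
  by apply: uQ; apply: subset_pattern CB => i iu; rewrite mem_cat iu orbT.
- exists B => // x C [V'x _] CB; apply: HB => //.
  by apply: subset_pattern CB => i it; rewrite mem_cat it.
Qed.

Lemma avoids_branch (x : X) (s : nat -> seq L) :
  (forall n, exists2 V, V x & avoids V (s n) (s n.+1)) ->
  nowhere_dense [set A | E (x, A)].
Proof.
move=> sP.
have /subset_nowhere_dense : [set A | E (x, A)] `<=` [set A | closure E (x, A)].
  by move=> A; exact: (@subset_closure _ E (x, A)).
apply; have clx : closed [set A | closure E (x, A)].
  have cx : continuous (fun A : hyperspace (cantor_cube L) => (x, A)).
    move=> A U [[P Q] [/= nP nQ] PQ]; apply: filterS nQ => B QB.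
    by apply: (PQ (x, B)); split=> //=; exact: nbhs_singleton nP.
  by move/continuous_closedP : cx; apply; exact: closed_closure.
rewrite /nowhere_dense -(closure_id _).1// -subset0 => A /pattern_nbhs_base[u uE].
have s_mono m n : (m <= n)%N -> {subset s m <= s n}.
  elim: n => [|n IHn]; first by rewrite leqn0 => /eqP->.
  rewrite leq_eqVlt => /predU1P[->//|]; rewrite ltnS => /IHn smn i /smn.
  by have [V _ [+ _]] := sP n; apply.
(* The [s n] increase and [u] is finite, so one [s n] contains every element of [u] occurring in any
   [s m]. *)
have [n un] : exists n, forall i m, i \in u -> i \in s m -> i \in s n.
  elim: (u) => [|i v [n vn]]; first by exists 0%N.
  have [[m im]|ni] := pselect (exists m, i \in s m).
    exists (maxn m n) => j k; rewrite inE => /predU1P[->|jv jk].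
      by move=> _; exact: s_mono (leq_maxl m n) _ im.
    exact: s_mono (leq_maxr m n) _ (vn _ _ jv jk).
  exists n => j k; rewrite inE => /predU1P[-> ik|]; last exact: vn.
  by exfalso; apply: ni; exists k.
have [V Vx [_ /(_ A)[B BA VB]]] := sP n.
(* [A] and [B] agree on [s n], which contains the overlap of [u] and [s n.+1]; the amalgam [C] would
   lie both in the section and outside it. *)
have [|C [CA CB]] := @pattern_amalgam _ u (s n) (s n.+1) A B _ (esym BA).
  by move=> i iu; exact: un.
exact: VB Vx CB (uE _ CA).
Qed.

End kuratowski_ulam.

Theorem hyperspace_uKU_star (L : eqType) : uKU_star (hyperspace (cantor_cube L)).
Proof.
move=> X E nE; have [H nH HE] := generic_branch [::] (avoids_extend nE).
exists (fun n => H n `&` [set x | ~ nowhere_dense [set z | E (x, z)]]).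
  by move=> n; apply: subset_nowhere_dense (nH n) => x [].
rewrite -setI_bigcupl; apply/esym/setIidPr => x nEx.
apply: contrapT => nHx; apply: nEx.
have [|s _ sP] := HE x; last exact: avoids_branch sP.
by move=> n Hnx; apply: nHx; exists n.
Qed.

(** * Free pairs *)

Lemma injective_card_le (T U : Type) (g : T -> U) :
  injective g -> [set: T] #<= [set: U].
Proof.
move=> ginj; have : g @` [set: T] #= [set: T].
  by apply: inj_card_eq => x y _ _; exact: ginj.
by move=> /card_eqPle[_ /card_le_trans]; apply; exact: card_leT.
Qed.

Lemma card_le_injective (T U : Type) (B : set U) :
  [set: T] #<= B -> exists2 g : T -> U, injective g & forall x, B (g x).
Proof.
move=> /card_leP/unsquash g.
exists (fun x => val (g (SigSub (mem_set (I : [set: T] x))))) => [x y|x].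
  by move=> /val_inj/inj; rewrite !inE => /(_ I I)[].
exact/set_mem/valP.
Qed.

(* A maximal disjoint family of countably infinite subsets covers [T] up to a
   finite set, and each member absorbs a factor [nat]. *)
Lemma card_setX_nat (T : Type) :
  infinite_set [set: T] -> [set: T * nat] #<= [set: T].
Proof.
move=> Tinf.
pose D : set (set T) := [set A | countable A /\ [set: nat] #<= A].
have [E [ED tE maxE]] := ex_maximal_disjoint_subcollection (@id (set T)) D.
pose rest := ~` \bigcup_(A in E) A.
have rest_fin : finite_set rest.
  apply: contrapT => /infiniteP/card_le_injective[g ginj g_rest].
  have Dg : D (range g).
    split; first by apply: sub_countable (card_image_le _ _) _.
    by have /card_eqPle[] : range g #= [set: nat] by
      apply: inj_card_eq => x y _ _; exact: ginj.
  apply: (maxE (E `|` [set range g])).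
  - split; first by move=> A; left.
    move=> /(_ (range g) (or_intror erefl)) Eg.
    by apply: (g_rest 0%N); exists (range g) => //; exists 0%N.
  - by move=> A [/ED//|->].
  - have disj A : E A -> ~ (A `&` range g !=set0).
      by move=> EA [y [Ay [n _ gny]]]; apply: (g_rest n); exists A; rewrite ?gny.
    move=> A B [EA|->] [EB|->] //=; first exact: tE.
      by move=> /(disj _ EA).
    by rewrite setIC => /(disj _ EB).
have [A0 EA0] : E !=set0.
  apply: contrapT => nE; apply: Tinf.
  apply: sub_finite_set rest_fin => x _ [A EA _].
  by apply: nE; exists A.
(* Leftover points are assigned to the fixed member [A0], so the fibres of [v] remain countable. *)
have /choice[v vP] : forall x, exists A, E A /\ (A x \/ A = A0 /\ rest x).
  move=> x; have [[A EA Ax]|nx] := pselect ((\bigcup_(A in E) A) x).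
    by exists A; split=> //; left.
  by exists A0; split=> //; right.
have /choice[e eP] : forall A, exists e : T -> nat, E A ->
    {in [set x | v x = A] &, injective e}.
  move=> A; have [EA|nEA] := pselect (E A); last by exists (cst 0%N).
  have : countable [set x | v x = A].
    apply: (@sub_countable _ _ _ (A `|` rest)).
      apply: subset_card_le => x /= <-.
      by have [_ [?|[_ ?]]] := vP x; [left|right].
    have -> : A `|` rest = \bigcup_(i in [set: bool]) (if i then A else rest).
      apply/seteqP; split=> x; first by case=> ?; [exists true|exists false].
      by case=> -[] _ ?; [left|right].
    apply: bigcup_countable => // -[] _; first exact: (ED _ EA).1.
    exact: finite_set_countable.
  by move=> /countable_injP[e einj]; exists e.
have /choice[g gP] : forall A, exists g : nat -> T, E A ->
    injective g /\ forall n, A (g n).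
  move=> A; have [EA|nEA] := pselect (E A).
    by have [g ginj gA] := card_le_injective (ED _ EA).2; exists g.
  by have [x _] := infinite_setN0 Tinf; exists (cst x) => /nEA.
apply: (@injective_card_le _ _ (fun xn : T * nat =>
  g (v xn.1) (choice.pickle (e (v xn.1) xn.1, xn.2)))).
move=> [x m] [y n] /= gxy.
have [Ex _] := vP x; have [Ey _] := vP y.
have vxy : v x = v y.
  apply: (tE _ _ Ex Ey); exists (g (v x) (choice.pickle (e (v x) x, m))); split.
    exact: (gP _ Ex).2.
  by rewrite gxy; exact: (gP _ Ey).2.
move: gxy; rewrite vxy => /((gP _ Ey).1) /(pcan_inj choice.pickleK)[exy ->].
by congr (_, _); apply: (eP _ Ey) => //; rewrite inE.
Qed.

(* An instance of Hajnal's free set theorem. *)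
Lemma free_pair (L : Type) (Phi : L -> set L) :
  omega1_lt L -> (forall x, countable (Phi x)) ->
  exists x y, ~ Phi x y /\ ~ Phi y x.
Proof.
move=> [W [R [[_ Wunc _] WL nLW]]] cPhi; apply: contrapT => nfree.
have Phi_total x y : Phi x y \/ Phi y x.
  by apply: contrapT => /not_orP nxy; apply: nfree; exists x, y.
have [i iinj _] := card_le_injective WL.
(* If [x] lay in no [Phi (i w)], the countable [Phi x] would contain a copy of [W]. Hence [W] many
   countable sets cover [L]. *)
have /choice[w wP] : forall x, exists w, Phi (i w) x.
  move=> x; apply: contrapT => /forallNP nx; apply: Wunc.
  apply: sub_countable (cPhi x).
  have /card_eqPle[_ /card_le_trans] : i @` [set: W] #= [set: W].
    by apply: inj_card_eq => ? ? _ _; exact: iinj.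
  apply; apply: subset_card_le => _ [u _ <-].
  by have [/nx|] := Phi_total (i u) x.
have /choice[e eP] : forall u, exists e : L -> nat, {in Phi u &, injective e}.
  by move=> u; have /countable_injP[e] := cPhi u; exists e.
apply: nLW; have : [set: L] #<= [set: W * nat].
  apply: (@injective_card_le _ _ (fun x => (w x, e (i (w x)) x))).
  move=> x y [wxy]; rewrite wxy => /eP; apply; rewrite inE //.
  by rewrite -wxy.
move=> /card_le_trans; apply; apply: card_setX_nat.
by move=> /finite_set_countable.
Qed.

(** * Non-dyadicity *)

Section not_dyadic.
Context {L K : choiceType}.
Variable f : cantor_cube K -> hyperspace (cantor_cube L).
Hypothesis f_surj : forall A, exists q, f q = A.
Variable supp : seq L -> {fset K}.
Hypothesis suppP : forall s p q, {in supp s, p =1 q} ->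
  pattern s (sval (f p)) = pattern s (sval (f q)).
Variable rho : nat -> L.

Let base n := mkseq rho n.
Let bsupp n x := supp (rcons (base n) x).

(* [x i = y i] is allowed. *)
Record independent_pairs (n m : nat) (t : {fset K}) (x y : nat -> L) : Prop := {
  pairs_disjoint : forall i j z, (i < m)%N -> (j < m)%N ->
    z \in [:: x i; y i] -> z \in [:: x j; y j] -> i = j;
  pairs_base : forall i z, (i < m)%N -> z \in [:: x i; y i] -> z \notin base n;
  pairs_supp : forall i, (i < m)%N -> (#|` supp [:: x i; y i]| <= n)%N;
  pairs_bsupp : forall i, (i < m)%N ->
    (bsupp n (x i) `&` bsupp n (y i) `<=` t)%fset
}.

(** * Counting closed sets built from independent pairs *)

Section counting.
Variables (n m : nat) (t : {fset K}) (x y : nat -> L).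
Hypothesis xyP : independent_pairs n m t x y.

Let func := {ffun 'I_m -> {ffun n.-tuple bool -> bool}}.
Let trace (a : cantor_cube L) : n.-tuple bool := [tuple a (rho j) | j < n].

Definition graph_set (h : func) : set (cantor_cube L) :=
  [set a | forall i : 'I_m, a (x i) = h i (trace a) /\ a (y i) = h i (trace a)].

Lemma graph_set_closed h : closed (graph_set h).
Proof.
apply: (@cylinder_closed _ (base n ++ flatten [seq [:: x i; y i] | i <- iota 0 m])).
move=> a b ab ha i.
have <- : trace a = trace b.
  apply: eq_from_tnth => j; rewrite !tnth_mktuple; apply: ab.
  by rewrite mem_cat (map_f rho) ?mem_iota//=.
have abi z : z \in [:: x i; y i] -> a z = b z.
  move=> zi; apply: ab; rewrite mem_cat; apply/orP; right.
  by apply/flatten_mapP; exists (i : nat); rewrite ?mem_iota/=.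
by rewrite -!abi ?inE ?eqxx ?orbT//; exact: ha.
Qed.

(** The pairs are disjoint from each other and from [base n], so values there can be prescribed
    independently. *)
Lemma graph_set_trace h (r : n.-tuple bool) : injective rho ->
  exists2 a, graph_set h a & trace a = r.
Proof.
move=> rinj; pose a z := if z \in base n then nth false r (index z (base n)) else
  if [pick i : 'I_m | z \in [:: x i; y i]] is Some i then h i r else false.
have ar : trace a = r.
  apply: eq_from_tnth => j; rewrite tnth_mktuple /a.
  have jb : rho j \in base n by rewrite (map_f rho) ?mem_iota/=.
  rewrite jb (tnth_nth false) -[X in index X _](nth_mkseq (rho 0%N) rho (ltn_ord j)).
  by rewrite index_uniq ?size_mkseq//; apply/mkseq_uniqP => ? ? _ _; exact: rinj.
exists a => // i.
have az z : z \in [:: x i; y i] -> a z = h i (trace a).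
  move=> zi; rewrite /a (negbTE (pairs_base xyP (ltn_ord i) zi)) ar.
  case: pickP => [j zj|/(_ i)]; last by rewrite zi.
  by rewrite (ord_inj (pairs_disjoint xyP (ltn_ord i) (ltn_ord j) zi zj)).
by rewrite !az ?inE ?eqxx ?orbT.
Qed.

Lemma independent_pairs_bound : injective rho -> (m <= #|` t|)%N.
Proof.
move=> rinj.
have /choice[q qP] : forall h, exists q, sval (f q) = graph_set h.
  move=> h; have h0 : closed (graph_set h) /\ graph_set h !=set0.
    split; first exact: graph_set_closed.
    by have [a ha _] := graph_set_trace h [tuple false | j < n] rinj; exists a.
  by have [q fq] := f_surj (exist _ _ h0 : hyperspace_of _); exists q; rewrite fq.
pose d i := supp [:: x i; y i].
pose W := (t : seq K) ++ flatten [seq (d i : seq K) | i <- iota 0 m].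
pose F h : (size W).-tuple bool := map_tuple (q h : K -> bool) (in_tuple W).
have Finj : injective F.
  move=> h h' /(congr1 val)/= /eq_in_map qhh'.
  have qt i : i \in t -> q h i = q h' i.
    by move=> it; apply: qhh'; rewrite mem_cat it.
  have qd (i : 'I_m) k : k \in d i -> q h k = q h' k.
    move=> kd; apply: qhh'; rewrite mem_cat; apply/orP; right.
    by apply/flatten_mapP; exists (i : nat); rewrite ?mem_iota/=.
  apply/ffunP => i; apply/ffunP => r.
  (* A hybrid that looks like [q h] to [x i] and to the pair, but like [q h'] to [y i]; this is
     consistent because [q h] and [q h'] agree on [t] and on [d i]. *)
  pose p : cantor_cube K := fun k =>
    if (k \in bsupp n (x i)) || (k \in d i) then q h k else q h' k.
  have px : {in bsupp n (x i), p =1 q h} by move=> k kx; rewrite /p kx.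
  have pd : {in d i, p =1 q h} by move=> k kd; rewrite /p kd orbT.
  have py : {in bsupp n (y i), p =1 q h'}.
    move=> k ky; rewrite /p; case: ifPn => // /orP[kx|/qd//].
    by apply/qt/(fsubsetP (pairs_bsupp xyP (ltn_ord i))); rewrite inE kx.
  (* Along [a], [b], [a'] the value [h i r] passes from [x i] to [y i] and becomes [h' i r]. *)
  have [a ha ar] := graph_set_trace h r rinj.
  have /eq_patternP[_ /(_ a)] := suppP px; rewrite qP => /(_ ha)[b fb ba].
  have /eq_patternP[/(_ b fb) + _] := suppP pd; rewrite qP => -[c hc bc].
  have /eq_patternP[/(_ b fb) + _] := suppP py; rewrite qP => -[a' ha' ba'].
  have bxy : b (x i) = b (y i).
    by rewrite !bc ?inE ?eqxx ?orbT//; have [-> ->] := hc i.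
  have a'r : trace a' = r.
    rewrite -ar; apply: eq_from_tnth => j; rewrite !tnth_mktuple.
    have jb : rho j \in base n by rewrite (map_f rho) ?mem_iota/=.
    by rewrite -ba' ?mem_rcons ?inE ?jb ?orbT// ba// mem_rcons inE jb orbT.
  have [hax _] := ha i; have [_ ha'y] := ha' i.
  rewrite -[in LHS]ar -hax -[in RHS]a'r -ha'y.
  by rewrite -ba ?mem_rcons ?inE ?eqxx// bxy ba'// mem_rcons inE eqxx.
have sW : (size W <= #|` t| + n * m)%N.
  rewrite size_cat leq_add2l size_flatten /shape -map_comp sumnE big_map.
  rewrite big_seq; apply: (@leq_trans (\sum_(i <- iota 0 m | i \in iota 0 m) n)).
    by apply: leq_sum => i; rewrite mem_iota => /(pairs_supp xyP).
  by rewrite -big_seq big_const_seq count_predT size_iota iter_addn addn0.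
have := leq_card F Finj.
rewrite !card_ffun card_tuple !card_bool card_ord card_tuple card_bool -expnM.
rewrite leq_exp2l// => /leq_trans/(_ sW) H.
(* As [n < 2 ^ n], this gives [n.+1 * m <= #|t| + n * m]. *)
have := leq_trans (leq_mul (ltn_expl n (isT : 1 < 2)%N) (leqnn m)) H.
by rewrite mulSn leq_add2r.
Qed.

End counting.

(** The bound gives a largest family of independent pairs; [Z] collects [base n] and its points, and
    a pair missing [Z] would enlarge the family. *)
Lemma finite_transversal (n : nat) (t : {fset K}) : injective rho ->
  exists Z : seq L, forall x y, (#|` supp [:: x; y]| <= n)%N ->
    (bsupp n x `&` bsupp n y `<=` t)%fset -> x \in Z \/ y \in Z.
Proof.
move=> rinj.
pose fam m := `[< exists x y, independent_pairs n m t x y >].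
have fam0 : exists m, fam m by exists 0%N; apply/asboolP; exists rho, rho; split.
have fam_bound m : fam m -> (m <= #|` t|)%N.
  by move=> /asboolP[x [y xyP]]; exact: independent_pairs_bound xyP rinj.
case: (ex_maxnP fam0 fam_bound) => m /asboolP[x [y [disj ba sx bx]]] m_max.
exists (base n ++ flatten [seq [:: x i; y i] | i <- iota 0 m]) => a b sab bab.
apply: contrapT => /not_orP[/negP aZ /negP bZ].
suff /m_max : fam m.+1 by rewrite ltnn.
apply/asboolP; exists (fun i => if (i < m)%N then x i else a),
  (fun i => if (i < m)%N then y i else b).
have newZ z : z \in [:: a; b] ->
    z \notin base n /\ forall i, (i < m)%N -> z \notin [:: x i; y i].
  have abZ : z \in [:: a; b] ->
      z \notin base n ++ flatten [seq [:: x i; y i] | i <- iota 0 m].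
    by rewrite !inE => /orP[]/eqP->.
  move=> /abZ; rewrite mem_cat negb_or => /andP[-> zf]; split=> // i im.
  by apply: contra zf => zi; apply/flatten_mapP; exists i; rewrite ?mem_iota.
have ltS i : (i < m.+1)%N -> i = m \/ (i < m)%N.
  by rewrite ltnS leq_eqVlt => /predU1P.
split=> [i j z /ltS[->|im] /ltS[->|jm]|i z /ltS[->|im]|i /ltS[->|im]|
    i /ltS[->|im]]; rewrite ?ltnn ?im ?jm //.
- by move=> /newZ[_ /(_ j jm)] + zj; rewrite zj.
- by move=> zi /newZ[_ /(_ i im)]; rewrite zi.
- exact: disj.
- by move=> /newZ[].
- exact: ba.
- exact: sx.
- exact: bx.
Qed.

Lemma countable_set_mapping : injective rho ->
  exists Phi : L -> set L, (forall x, countable (Phi x)) /\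
    forall x y, Phi x y \/ Phi y x.
Proof.
move=> rinj.
have /choice[Z ZP] : forall nt : nat * {fset K}, exists Z : seq L, forall x y,
    (#|` supp [:: x; y]| <= nt.1)%N ->
    (bsupp nt.1 x `&` bsupp nt.1 y `<=` nt.2)%fset -> x \in Z \/ y \in Z.
  by move=> nt; exact: finite_transversal.
exists (fun x => \bigcup_(n in [set: nat])
  \bigcup_(t in [set` fpowerset (bsupp n x)]) [set` Z (n, t)]); split=> [x|x y].
- apply: bigcup_countable => // n _; apply: bigcup_countable.
    exact/finite_set_countable/finite_fset.
  by move=> t _; exact/finite_set_countable/finite_seq.
(* This [t] is a subset of both supports, so whichever of [x], [y] lies in [Z (n, t)] belongs to
   [Phi] of the other. *)
- pose n := #|` supp [:: x; y]|; pose t := (bsupp n x `&` bsupp n y)%fset.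
  have [xZ|yZ] := ZP (n, t) x y (leqnn _) (fsubset_refl _).
    by right; exists n => //; exists t => //=; rewrite fpowersetE fsubsetIr.
  by left; exists n => //; exists t => //=; rewrite fpowersetE fsubsetIl.
Qed.

End not_dyadic.

Theorem hyperspace_not_dyadic (L : choiceType) : omega1_lt L ->
  ~ dyadic (hyperspace (cantor_cube L)).
Proof.
move=> L_large [_ _ [K0 [f0 [f0_cont f0_range]]]].
(* Finite sets of coordinates need a choice structure on the index type. *)
pose K := {classic K0}.
pose f : cantor_cube K -> hyperspace (cantor_cube L) := f0.
have f_cont : continuous f by exact: f0_cont.
have f_surj A : exists q, f q = A.
  have : range f0 A by rewrite f0_range.
  by case=> q _ <-; exists q.
have /choice[supp suppP] : forall s : seq L, exists u : {fset K},
    forall p q : cantor_cube K, {in u, p =1 q} ->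
    pattern s (sval (f p)) = pattern s (sval (f q)).
  move=> s; have [|u uP] := @locally_constant_finite_support K _
      (fun q => pattern s (sval (f q))).
    by move=> q; exact: (f_cont q _ (pattern_nbhs s (f q))).
  exists [fset k in u]%fset => p q pq; apply: uP => k ku; apply: pq.
  by rewrite inE.
have [rho rho_inj] : exists rho : nat -> L, injective rho.
  have [W [R [[_ Wunc _] WL _]]] := L_large.
  have /infiniteP/card_le_trans/(_ WL)/card_le_injective[rho rho_inj _] :
      infinite_set [set: W] by move=> /finite_set_countable.
  by exists rho.
have [Phi [cPhi Phi_total]] := countable_set_mapping f_surj suppP rho_inj.
have [x [y [nxy nyx]]] := free_pair L_large cPhi.
by have [] := Phi_total x y.
Qed.

Theorem corollary10 (L : Type) (hL : omega1_lt L) :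
  uKU_star (hyperspace (cantor_cube L)) /\
  ~ dyadic (hyperspace (cantor_cube L)).
Proof.
split; first exact: (@hyperspace_uKU_star {classic L}).
exact: (@hyperspace_not_dyadic {classic L}).
Qed.
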